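(* Let $V$ be the affine cone in $\mathbb{A}^{n+1}$ over a projectively normal subvariety $X\subset\mathbb{P}^n$. Suppose that $V$ is rigid and $\operatorname{Aut}(X)$ is finite. Then there exists an exact sequence of groups $$1\longrightarrow\mathbb{G}_{\mathrm{m}}\longrightarrow\operatorname{Aut}(V)\longrightarrow\operatorname{Aut}(X),$$ so that $\operatorname{Aut}(V)$ is a finite extension of the torus $\mathbb{G}_{\mathrm{m}}$ by a finite subgroup in $\operatorname{Aut}(X)$.
   Context: All varieties are defined over an algebraically closed field $\Bbbk$ of characteristic $0$. $\mathbb{G}_{\mathrm{a}}$ is the one-dimensional unipotent additive group and $\mathbb{G}_{\mathrm{m}}$ is the one-dimensional algebraic torus over $\Bbbk$. An affine variety is called rigid if it does not admit an effective $\mathbb{G}_{\mathrm{a}}$-action. The affine cone over a closed subvariety $X\subset\mathbb{P}^n$ is the closed subvariety of $\mathbb{A}^{n+1}$ defined by the homogeneous ideal of $X$. *)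

(* Defs.v *)
From HB Require Import structures.
From mathcomp Require Import all_boot all_order all_algebra.
From mathcomp Require Import boolp classical_sets functions cardinality.
From mathcomp Require Import mpoly.

Set Implicit Arguments.
Unset Strict Implicit.
Unset Printing Implicit Defensive.

Import GRing.Theory.
Local Open Scope classical_set_scope.
Local Open Scope ring_scope.

(* For affine and for projective varieties alike, the morphisms X -> X form a
   monoid of self-maps of the set of points, and an automorphism is a morphism
   having a two-sided inverse which is a morphism. *)

Record endo_monoid (T : Type) := EndoMonoid {
  endo_of : set (T -> T);
  endo_id : endo_of id;
  endo_comp : forall f g, endo_of f -> endo_of g -> endo_of (f \o g) }.

Definition is_aut T (M : endo_monoid T) (f : T -> T) : Prop :=
  endo_of M f /\ exists g : T -> T, [/\ endo_of M g, cancel f g & cancel g f].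

Definition aut (T : choiceType) (M : endo_monoid T) : Type :=
  {f : T -> T | `[< is_aut M f >]}.

HB.instance Definition _ (T : choiceType) (M : endo_monoid T) :=
  Choice.on (aut M).

Definition aut_fun (T : choiceType) (M : endo_monoid T) (f : aut M) : T -> T :=
  val f.
Coercion aut_fun : aut >-> Funclass.

Section AutGroup.
Variables (T : choiceType) (M : endo_monoid T).
Implicit Types f g : aut M.

Let autP f : is_aut M f. Proof. exact: asboolW (valP f). Qed.

Lemma is_aut_id : is_aut M id.
Proof. by split; [exact: endo_id | exists id; split=> //; exact: endo_id]. Qed.

Lemma is_aut_comp f g : is_aut M (f \o g).
Proof.
have [Mf [f' [Mf' fK f'K]]] := autP f; have [Mg [g' [Mg' gK g'K]]] := autP g.
split; first exact: endo_comp.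
exists (g' \o f'); split; first exact: endo_comp.
  exact: can_comp.
exact: can_comp.
Qed.

Lemma aut_inv_subproof f :
  exists g : T -> T, [/\ is_aut M g, cancel f g & cancel g f].
Proof.
have [Mf [g [Mg fK gK]]] := autP f; exists g; split=> //; split=> //.
by exists (f : T -> T).
Qed.

Definition aut_one : aut M := exist _ id (asboolT is_aut_id).
Definition aut_mul f g : aut M := exist _ (f \o g) (asboolT (is_aut_comp f g)).
Definition aut_inv f : aut M :=
  let: exist g gP := cid (aut_inv_subproof f) in
  exist _ g (asboolT (and3_rec (fun H _ _ => H) gP)).

Lemma aut_invK f : cancel (aut_inv f) f.
Proof. by rewrite /aut_inv; case: cid => g []. Qed.

Lemma autK f : cancel f (aut_inv f).
Proof. by rewrite /aut_inv; case: cid => g []. Qed.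

Lemma aut_eqP f g : f =1 g -> f = g.
Proof. by move=> fg; apply/val_inj/funext. Qed.

Lemma aut_mulA : associative aut_mul. Proof. by move=> f g h; exact: aut_eqP. Qed.
Lemma aut_mul1 : left_id aut_one aut_mul. Proof. by move=> f; exact: aut_eqP. Qed.
Lemma aut_mulr1 : right_id aut_one aut_mul.
Proof. by move=> f; exact: aut_eqP. Qed.
Lemma aut_mulV : left_inverse aut_one aut_inv aut_mul.
Proof. by move=> f; apply: aut_eqP => x; exact: autK. Qed.
Lemma aut_mulrV : right_inverse aut_one aut_inv aut_mul.
Proof. by move=> f; apply: aut_eqP => x; exact: aut_invK. Qed.

HB.instance Definition _ := isGroup.Build (aut M)
  aut_mulA aut_mul1 aut_mulr1 aut_mulV aut_mulrV.

End AutGroup.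

Definition Gm (k : fieldType) : Type := {t : k | t != 0}.

HB.instance Definition _ (k : fieldType) := Choice.on (Gm k).

Section Torus.
Variable k : fieldType.
Implicit Types s t : Gm k.

Definition Gm_one : Gm k := exist _ 1 (oner_neq0 k).
Definition Gm_mul s t : Gm k :=
  exist _ (val s * val t) (mulf_neq0 (valP s) (valP t)).
Definition Gm_inv t : Gm k := exist _ (val t)^-1 (invr_neq0 (valP t)).

Lemma Gm_mulA : associative Gm_mul.
Proof. by move=> r s t; apply: val_inj; exact: mulrA. Qed.
Lemma Gm_mul1 : left_id Gm_one Gm_mul.
Proof. by move=> t; apply: val_inj; exact: mul1r. Qed.
Lemma Gm_mulr1 : right_id Gm_one Gm_mul.
Proof. by move=> t; apply: val_inj; exact: mulr1. Qed.
Lemma Gm_mulV : left_inverse Gm_one Gm_inv Gm_mul.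
Proof. by move=> t; apply: val_inj; exact: mulVf (valP t). Qed.
Lemma Gm_mulrV : right_inverse Gm_one Gm_inv Gm_mul.
Proof. by move=> t; apply: val_inj; exact: mulfV (valP t). Qed.

HB.instance Definition _ := isGroup.Build (Gm k)
  Gm_mulA Gm_mul1 Gm_mulr1 Gm_mulV Gm_mulrV.

End Torus.

Definition eval_at (k : fieldType) (m : nat) (f : {mpoly k[m]}) (v : 'rV[k]_m) :
  k := f.@[v 0].

Definition poly_map (k : fieldType) (m p : nat) (P : 'I_p -> {mpoly k[m]})
  (v : 'rV[k]_m) : 'rV[k]_p := \row_i eval_at (P i) v.

Definition poly_comp (k : fieldType) (m p q : nat) (P : 'I_q -> {mpoly k[p]})
  (Q : 'I_p -> {mpoly k[m]}) (i : 'I_q) : {mpoly k[m]} :=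
  P i \mPo [tuple Q j | j < p].

Lemma poly_map_comp (k : fieldType) (m p q : nat) (P : 'I_q -> {mpoly k[p]})
    (Q : 'I_p -> {mpoly k[m]}) v :
  poly_map (poly_comp P Q) v = poly_map P (poly_map Q v).
Proof.
apply/rowP => i; rewrite !mxE /eval_at comp_mpoly_meval.
by apply: meval_eq => j; rewrite !mxE tnth_mktuple.
Qed.

Lemma poly_map_id (k : fieldType) (m : nat) (v : 'rV[k]_m) :
  poly_map (fun i => 'X_i) v = v.
Proof. by apply/rowP => i; rewrite mxE /eval_at mevalXU. Qed.

Section Affine.
Variables (k : fieldType) (m : nat) (V : set 'rV[k]_m).

Definition regular_endo : set (V -> V) :=
  [set f | exists P, forall v : V, val (f v) = poly_map P (val v)].

Lemma regular_endo_id : regular_endo id.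
Proof. by exists (fun i => 'X_i) => v; rewrite poly_map_id. Qed.

Lemma regular_endo_comp f g :
  regular_endo f -> regular_endo g -> regular_endo (f \o g).
Proof.
move=> [P fP] [Q gQ]; exists (poly_comp P Q) => v.
by rewrite poly_map_comp -gQ -fP.
Qed.

Definition affine_endo := EndoMonoid regular_endo_id regular_endo_comp.

Definition affine_aut := aut affine_endo.

(* The last clause says that (t, v) |-> a t v is a morphism A^1 x V -> V, where
   A^1 x V is embedded in the affine space of dimension 1 + m. *)
Definition Ga_action (a : k -> V -> V) : Prop :=
  [/\ forall v, a 0 v = v,
      forall s t v, a (s + t) v = a s (a t v)
    & exists P : 'I_m -> {mpoly k[1 + m]},
        forall t v, val (a t v) = poly_map P (row_mx t%:M (val v))].

Definition effective (a : k -> V -> V) : Prop :=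
  forall t, (forall v, a t v = v) -> t = 0.

Definition rigid : Prop := ~ exists2 a, Ga_action a & effective a.

End Affine.

HB.instance Definition _ (k : fieldType) (m : nat) (V : set 'rV[k]_m) :=
  Group.on (affine_aut V).

(* P^n is the set of lines through the origin of k^(n+1). *)
Definition projspace (k : fieldType) (n : nat) : Type :=
  {L : {vspace 'rV[k]_n.+1} | \dim L == 1%N}.

HB.instance Definition _ (k : fieldType) (n : nat) := Choice.on (projspace k n).

Section Projective.
Variables (k : fieldType) (n : nat).
Implicit Types (f : {mpoly k[n.+1]}) (x : projspace k n) (X : set (projspace k n)).

(* v is a vector of homogeneous coordinates of x; such a v is nonzero. *)
Definition coords x (v : 'rV[k]_n.+1) : Prop := val x = <[v]>%VS.

Lemma coords_neq0 x v : coords x v -> v != 0.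
Proof.
by rewrite /coords => xv; have := valP x; rewrite /= xv dim_vline eqb1.
Qed.

Definition homogeneous f : Prop := exists d, f \is d.-homog.

Definition vanishes_at f x : Prop := forall v, coords x v -> eval_at f v = 0.

Definition closed_subset X : Prop :=
  exists2 S : set {mpoly k[n.+1]}, S `<=` homogeneous
    & X = [set x | forall f, S f -> vanishes_at f x].

Definition subvariety X : Prop :=
  [/\ closed_subset X, X !=set0
    & forall Y Z, closed_subset Y -> closed_subset Z -> X = Y `|` Z ->
        X = Y \/ X = Z].

Definition ideal_gen (R : comNzRingType) (S : set R) : set R :=
  [set f | exists2 s : seq (R * R), forall c, c \in s -> S c.2
             & f = \sum_(c <- s) c.1 * c.2].

Definition homogeneous_ideal X : set {mpoly k[n.+1]} :=
  ideal_gen [set f | homogeneous f /\ forall x, X x -> vanishes_at f x].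

Definition affine_cone X : set 'rV[k]_n.+1 :=
  [set v | forall f, homogeneous_ideal X f -> eval_at f v = 0].

(* The kernel condition identifies the image of phi with the homogeneous
   coordinate ring k[x_0, .., x_n] / I(X), and the next one makes K the fraction
   field of that image: the coordinate ring is integrally closed in its
   fraction field. *)
Definition projectively_normal X : Prop :=
  exists (K : fieldType) (phi : {rmorphism {mpoly k[n.+1]} -> K}),
    [/\ forall f, phi f = 0 <-> homogeneous_ideal X f,
        forall z, exists f g, phi g != 0 /\ z = phi f / phi g
      & forall z, integralOver phi z -> exists f, z = phi f].

Variable X : set (projspace k n).

(* Near each point, a morphism is given by n + 1 forms of the same degree
   without common zero at that point. *)
Definition projective_regular_endo : set (X -> X) :=
  [set h | forall x : X, exists (d : nat) (F : 'I_n.+1 -> {mpoly k[n.+1]}),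
     [/\ forall i, F i \is d.-homog,
         forall v, coords (val x) v -> poly_map F v != 0
       & forall (y : X) v, coords (val y) v -> poly_map F v != 0 ->
           coords (val (h y)) (poly_map F v)]].

Lemma projective_regular_endo_id : projective_regular_endo id.
Proof.
move=> x; exists 1%N, (fun i => 'X_i); split=> [i|v /coords_neq0|y v yv _].
- by rewrite dhomogX /= mdeg1.
- by rewrite poly_map_id.
- by rewrite poly_map_id.
Qed.

Lemma dhomog_poly_comp d e (P Q : 'I_n.+1 -> {mpoly k[n.+1]}) :
  (forall i, P i \is d.-homog) -> (forall i, Q i \is e.-homog) ->
  forall i, poly_comp P Q i \is (e * d).-homog.
Proof.
move=> Pd Qe i; rewrite /poly_comp comp_mpolyEX big_seq.
apply: rpred_sum => m mP; apply: dhomogZ; rewrite comp_mpolyX.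
suff -> : (e * d = \sum_(j < n.+1) e * m j)%N.
  elim/big_ind2: _ => [|u a w b ua wb|j _]; first exact: dhomog1.
    exact: dhomogM.
  by rewrite tnth_mktuple; exact: dhomogMn.
have <- : mdeg m = d := dhomog_mf (Pd i) mP.
by rewrite mdegE big_distrr.
Qed.

Lemma eval_at_scale d f c v :
  f \is d.-homog -> eval_at f (c *: v) = c ^+ d * eval_at f v.
Proof.
move=> fd; rewrite /eval_at !mevalE mulr_sumr big_seq [RHS]big_seq.
apply: eq_bigr => m mf; rewrite mulrCA; congr (_ * _).
have <- : mdeg m = d := dhomog_mf fd mf.
rewrite mdegE expr_sum -big_split /=.
by apply: eq_bigr => i _; rewrite mxE exprMn.
Qed.

Lemma coords_scale x v w :
  coords x v -> coords x w -> exists2 c, c != 0 & w = c *: v.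
Proof.
move=> xv xw; have: w \in <[v]>%VS by rewrite -xv xw memv_line.
case/vlineP=> c wE; exists c => //; apply: contraNneq (coords_neq0 xw) => c0.
by rewrite wE c0 scale0r.
Qed.

Lemma coords_ex x : exists v, coords x v.
Proof.
have /eqP x1 := valP x; have := vbasisP (val x); rewrite /coords.
case: (vbasis _) => [[|v [|? ?]]]; rewrite /= x1 // => _ /span_basis xv.
by exists v; rewrite -xv span_seq1.
Qed.

Lemma projective_regular_endo_comp g h :
  projective_regular_endo g -> projective_regular_endo h ->
  projective_regular_endo (g \o h).
Proof.
move=> gR hR x.
have [e [Q [Qe Qx hQ]]] := hR x; have [d [P [Pd Px gP]]] := gR (h x).
have [u xu] := coords_ex (val x).
have [j Qju] : exists j, eval_at (Q j) u != 0.
  by have /rV0Pn[j] := Qx _ xu; rewrite mxE; exists j.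
have RE v : poly_map (fun i => Q j * poly_comp P Q i) v =
    eval_at (Q j) v *: poly_map P (poly_map Q v).
  rewrite -poly_map_comp.
  by apply/rowP => i; rewrite !mxE /eval_at mevalM.
exists (e + e * d)%N, (fun i => Q j * poly_comp P Q i); split.
- by move=> i; apply: dhomogM (Qe j) (dhomog_poly_comp Pd Qe i).
- move=> v xv; rewrite RE scaler_eq0 negb_or; apply/andP; split.
    have [c c0 ->] := coords_scale xu xv.
    by rewrite (eval_at_scale _ _ (Qe j)) mulf_neq0 // expf_neq0.
  by apply: Px; apply: hQ => //; exact: Qx.
- move=> y v yv; rewrite RE scaler_eq0 negb_or => /andP[Qjv PQv].
  have Qv : poly_map Q v != 0 by apply/rV0Pn; exists j; rewrite mxE.
  rewrite /coords (gP _ _ (hQ _ _ yv Qv) PQv) /=.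
  apply/eqP; rewrite eqEsubv -!memvE; apply/andP; split; apply/vlineP.
    exists (eval_at (Q j) v)^-1; by rewrite scalerA mulVf // scale1r.
  by exists (eval_at (Q j) v).
Qed.

Definition projective_endo :=
  EndoMonoid projective_regular_endo_id projective_regular_endo_comp.

Definition projective_aut := aut projective_endo.

End Projective.

HB.instance Definition _ (k : fieldType) (n : nat) (X : set (projspace k n)) :=
  Group.on (projective_aut X).

(* Main.v *)
Require Import Defs.
From HB Require Import structures.
From mathcomp Require Import all_boot all_order all_algebra.
From mathcomp Require Import boolp classical_sets functions cardinality.
From mathcomp Require Import mpoly.
From mathcomp Require Import zify.

Set Implicit Arguments.
Unset Strict Implicit.
Unset Printing Implicit Defensive.

Import GRing.Theory Num.Theory.
Local Open Scope classical_set_scope.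
Local Open Scope ring_scope.

(** Write V for the cone, and let an element t of k act on V by the dilation
    v |-> t v. Everything follows from one fact: each automorphism g of V
    commutes with the dilations. Then g is linear on V, it acts on the lines
    contained in V, that is on X, and g lies in the kernel of Aut(V) -> Aut(X)
    when every vector of V is an eigenvector of g.

    Consider the conjugated action tau_t(v) = g^-1 (t . g v).

    First, tau_t commutes with the dilations (conjugate_dilate_linear). Expand
    tau_(1+s)(v) in powers of s and in homogeneous parts with respect to v. If a
    part of degree d <> 1 occurred at s^m with m > 0, take such a term with the
    extremal slope (d - 1) / m. Conjugating tau_(1 + s e^p) by the dilation by
    e^q, with p / q this slope, gives a family that is polynomial in e; its limit
    at e = 0 keeps only the terms of extremal slope. As
    (1 + s e^p)(1 + t e^p) = 1 + (s + t + s t e^p) e^p, the torus law degenerates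
    to the additive law, so that the limit is a Ga-action on V. It is not
    constant in s, hence it is effective in characteristic 0, against rigidity
    (weight0_eval, degree1_only).

    Second, tau_t preserves every line of V (conjugate_preserves_lines): it
    commutes with dilations, so it induces an automorphism of X, and t |-> tau_t
    gives a homomorphism from the divisible group k^* to the finite group Aut(X),
    which is trivial.

    Third, g commutes with dilations (aut_equivariant): by the second point for g
    and for g^-1, both restrict to mutually inverse polynomial maps between the
    line k v and the line k g(v). Such maps have degree 1; they fix 0, so they
    are linear.

    Finally, let g be a linear map having all vectors of V as eigenvectors. The
    eigenvalue is a rational function on V, and it is an eigenvalue of the matrix
    of g over the function field. The characteristic polynomial has coefficients
    in the algebraically closed field k, so that the eigenvalue is a constant
    (eigenvalue_constant), and g is a dilation. *)

(** * Polynomial functions of one variable *)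

Section PolynomialFunctions.
Variable k : fieldType.

Definition polyfun (F : k -> k) : Prop :=
  exists p : {poly k}, forall x, F x = p.[x].

Lemma polyfun_ext F G : F =1 G -> polyfun F -> polyfun G.
Proof. by move=> FG [p Fp]; exists p => x; rewrite -FG. Qed.

Lemma polyfun_cst c : polyfun (fun=> c).
Proof. by exists c%:P => x; rewrite hornerC. Qed.

Lemma polyfun_id : polyfun id.
Proof. by exists 'X => x; rewrite hornerX. Qed.

Lemma polyfunD F G : polyfun F -> polyfun G -> polyfun (fun x => F x + G x).
Proof. by move=> [p Fp] [q Gq]; exists (p + q) => x; rewrite hornerD Fp Gq. Qed.

Lemma polyfunM F G : polyfun F -> polyfun G -> polyfun (fun x => F x * G x).
Proof. by move=> [p Fp] [q Gq]; exists (p * q) => x; rewrite hornerM Fp Gq. Qed.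

Lemma polyfunX F m : polyfun F -> polyfun (fun x => F x ^+ m).
Proof. by move=> [p Fp]; exists (p ^+ m) => x; rewrite horner_exp Fp. Qed.

Lemma polyfun_sum I (r : seq I) (P : pred I) (F : I -> k -> k) :
  (forall i, polyfun (F i)) -> polyfun (fun x => \sum_(i <- r | P i) F i x).
Proof.
move=> FP; elim: r => [|i r IHr].
  by apply: polyfun_ext (polyfun_cst 0) => x; rewrite big_nil.
case Pi: (P i); last by apply: polyfun_ext IHr => x; rewrite big_cons Pi.
by apply: polyfun_ext (polyfunD (FP i) IHr) => x; rewrite big_cons Pi.
Qed.

Lemma polyfun_prod I (r : seq I) (F : I -> k -> k) :
  (forall i, polyfun (F i)) -> polyfun (fun x => \prod_(i <- r) F i x).
Proof.
move=> FP; elim: r => [|i r IHr].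
  by apply: polyfun_ext (polyfun_cst 1) => x; rewrite big_nil.
by apply: polyfun_ext (polyfunM (FP i) IHr) => x; rewrite big_cons.
Qed.

Lemma polyfun_eval n (f : {mpoly k[n]}) (w : k -> 'rV[k]_n) :
  (forall i, polyfun (fun x => w x 0 i)) -> polyfun (fun x => eval_at f (w x)).
Proof.
move=> wP; apply: polyfun_ext (fun x => esym (mevalE _ f)) _.
apply: polyfun_sum => m; apply: polyfunM; first exact: polyfun_cst.
by apply: polyfun_prod => i; apply: polyfunX.
Qed.

Hypothesis char0 : [pchar k] =i pred0.

(** In characteristic 0 the multiples j t with j > 0 of t <> 0 are infinitely many. *)
Lemma poly_eq_on_multiples (p q : {poly k}) t : t != 0 ->
  (forall j, p.[j.+1%:R * t] = q.[j.+1%:R * t]) -> p = q.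
Proof.
move=> t0 pq; apply/eqP; rewrite -subr_eq0; apply: contraT => pq0.
pose s := [seq j.+1%:R * t | j <- iota 0 (size (p - q))].
have sroot : all (root (p - q)) s.
  by apply/allP=> _ /mapP[j _ ->]; rewrite rootE hornerD hornerN pq subrr.
have suniq : uniq s.
  rewrite map_inj_uniq ?iota_uniq // => i j /(mulIf t0) ij.
  wlog le_ij : i j ij / (i <= j)%N.
    by move=> H; case/orP: (leq_total i j) => /H->.
  have /eqP : (j - i)%:R == 0 :> k.
    by rewrite -[X in X%:R]subSS natrB // ij subrr.
  by move/eqP; rewrite ((pcharf0P k).1 char0); lia.
by have := max_poly_roots pq0 sroot suniq; rewrite size_map size_iota ltnn.
Qed.

Lemma poly_eq_off0 (p q : {poly k}) :
  (forall x, x != 0 -> p.[x] = q.[x]) -> p = q.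
Proof.
move=> pq; apply: (poly_eq_on_multiples (oner_neq0 k)) => j; apply: pq.
by rewrite mulr1 ((pcharf0P k).1 char0).
Qed.

(** This is how limits at 0 are taken below: an identity between polynomial
    functions that holds for nonzero parameters persists at the parameter 0. *)
Lemma polyfun_eq_off0 F G : polyfun F -> polyfun G ->
  (forall x, x != 0 -> F x = G x) -> F =1 G.
Proof.
move=> [p Fp] [q Gq] FG x; rewrite Fp Gq; congr _.[x].
by apply: poly_eq_off0 => y y0; rewrite -Fp -Gq FG.
Qed.

Lemma sum_powers_inj D (c c' : nat -> k) :
  (forall x, x != 0 -> \sum_(d < D) c d * x ^+ d = \sum_(d < D) c' d * x ^+ d) ->
  forall d, (d < D)%N -> c d = c' d.
Proof.
move=> cc' d dD.
have : \poly_(i < D) c i = \poly_(i < D) c' i.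
  by apply: poly_eq_off0 => x x0; rewrite !horner_poly cc'.
by move/(congr1 (coefp d)); rewrite /= !coef_poly dD.
Qed.

End PolynomialFunctions.

(** * Degeneration of a torus action on a rigid cone *)

Section HomogeneousParts.
Variables (k : fieldType) (n : nat).
Implicit Types (f : {mpoly k[n]}) (v : 'rV[k]_n).

Lemma eval_at_hparts f N v : (msize f <= N)%N ->
  eval_at f v = \sum_(d < N) eval_at (pihomog mdeg d f) v.
Proof.
by move=> fN; rewrite {1}(@pihomog_partitionE _ _ mdeg N f fN) /eval_at raddf_sum.
Qed.

End HomogeneousParts.

Section Degeneration.
Variables (k : fieldType) (n : nat) (V : set 'rV[k]_n.+1).
Hypothesis char0 : [pchar k] =i pred0.
Variable S : set {mpoly k[n.+1]}.
Hypothesis VE : forall v, V v <-> forall f, S f -> eval_at f v = 0.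
Hypothesis Vscale : forall c v, V v -> V (c *: v).
Hypothesis Vrigid : rigid V.

Variables (N : nat) (b : 'I_n.+1 -> nat -> nat -> {mpoly k[n.+1]}).
Hypothesis b_homog : forall i m d, b i m d \is d.-homog.

(** The action of the torus element 1 + s, expanded at s = 0: the polynomial
    b i m d is the part of degree d of the coefficient of s^m in coordinate i.
    The hypotheses below are those of an action of the multiplicative monoid k,
    written in the parameter s; the law of the monoid is then s + t + s t. *)
Definition expanded_action (s : k) (v : 'rV[k]_n.+1) : 'rV[k]_n.+1 :=
  \row_i \sum_(m < N) \sum_(d < N) s ^+ m * eval_at (b i m d) v.
Local Notation T := expanded_action.

Hypothesis T_V : forall s v, V v -> V (T s v).
Hypothesis T_0 : forall v, V v -> T 0 v = v.
Hypothesis T_mul : forall s t v, V v -> T s (T t v) = T (s + t + s * t) v.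

Section Weight.
Variables (p : nat) (q : int).
Hypotheses (p_gt0 : (0 < p)%N) (q_neq0 : q != 0).

(** Conjugation by the dilation by e^q, together with the substitution of s e^p
    for s, multiplies the term of s-degree m and of degree d by e^(weight m d).
    The number q may be negative: positive q serve to exclude the degrees d > 1,
    negative q to exclude d = 0. *)
Definition weight (m d : nat) : int := (p * m)%N%:Z - q * (d%:Z - 1).

Hypothesis weight_ge0 : forall i (m d : 'I_N) v,
  V v -> eval_at (b i m d) v != 0 -> 0 <= weight m d.

(** The absolute value only makes the exponent a natural number: on V the terms of
    negative weight vanish. So this is polynomial in e, which gives a meaning to
    the value at e = 0 in spite of the factor e^q or e^(-q) in rescaledE. *)
Definition rescaled (e s : k) (v : 'rV[k]_n.+1) : 'rV[k]_n.+1 :=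
  \row_i \sum_(m < N) \sum_(d < N)
    s ^+ m * e ^+ `|weight m d|%N * eval_at (b i m d) v.
Local Notation R := rescaled.

Lemma rescaledE e s v : e != 0 -> V v ->
  R e s v = e ^ q *: T (s * e ^+ p) (e ^ (- q) *: v).
Proof.
move=> e0 Vv; apply/rowP => i; rewrite !mxE mulr_sumr; apply: eq_bigr => m _.
rewrite mulr_sumr; apply: eq_bigr => d _.
rewrite (eval_at_scale _ _ (b_homog _ _ _)).
have [->|bv] := eqVneq (eval_at (b i m d) v) 0; first by rewrite !mulr0.
rewrite !mulrA; congr (_ * _).
have -> : e ^+ `|weight m d| = e ^ weight m d.
  by rewrite exprnP gez0_abs // (weight_ge0 Vv bv).
rewrite exprMn mulrCA -!mulrA; congr (_ * _).
rewrite -exprM !exprnP exprz_exp -!expfzDr //; congr (_ ^ _).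
by rewrite /weight; lia.
Qed.

Lemma rescaled_V e s v : e != 0 -> V v -> V (R e s v).
Proof. by move=> e0 Vv; rewrite rescaledE //; do ?[apply: Vscale | apply: T_V]. Qed.

Lemma polyfun_rescaled (s : k -> k) (w : k -> 'rV[k]_n.+1) :
  polyfun s -> (forall i, polyfun (fun e => w e 0 i)) ->
  forall i, polyfun (fun e => R e (s e) (w e) 0 i).
Proof.
move=> sP wP i.
apply: (@polyfun_ext _ (fun e => \sum_(m < N) \sum_(d < N)
    s e ^+ m * e ^+ `|weight m d|%N * eval_at (b i m d) (w e))) => [e|].
  by rewrite mxE.
apply: polyfun_sum => m; apply: polyfun_sum => d.
apply: polyfunM; last exact: polyfun_eval.
by apply: polyfunM; apply: polyfunX => //; exact: polyfun_id.
Qed.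

Lemma limit_V s v : V v -> V (R 0 s v).
Proof.
move=> Vv; apply/VE => f Sf.
apply: (@polyfun_eq_off0 _ char0 (fun e => eval_at f (R e s v)) (fun=> 0)).
- by apply/polyfun_eval/polyfun_rescaled => [|i]; exact: polyfun_cst.
- exact: polyfun_cst.
- by move=> e e0; have /VE -> := rescaled_V s e0 Vv.
Qed.

Lemma limit_0 v : V v -> R 0 0 v = v.
Proof.
move=> Vv; apply/rowP => i.
apply: (@polyfun_eq_off0 _ char0 (fun e => R e 0 v 0 i) (fun=> v 0 i)).
- by apply: polyfun_rescaled => [|j]; exact: polyfun_cst.
- exact: polyfun_cst.
- move=> e e0; rewrite rescaledE // mul0r T_0; last exact: Vscale.
  by rewrite scalerA -expfzDr // subrr expr0z scale1r.
Qed.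

Lemma rescaled_mul e s t v : e != 0 -> V v ->
  R e s (R e t v) = R e (s + t + s * t * e ^+ p) v.
Proof.
move=> e0 Vv; rewrite (rescaledE s e0 (rescaled_V t e0 Vv)) (rescaledE t e0 Vv).
rewrite scalerA -expfzDr // addNr expr0z scale1r T_mul; last exact: Vscale.
rewrite [RHS]rescaledE //; congr (_ *: T _ _).
by rewrite !mulrDl mulrACA mulrA.
Qed.

(** The term s t e^p, by which the law of the multiplicative monoid differs from
    the additive law, disappears at e = 0 because p > 0. *)
Lemma limit_add s t v : V v -> R 0 (s + t) v = R 0 s (R 0 t v).
Proof.
move=> Vv; apply/rowP => i.
have := @polyfun_eq_off0 _ char0 (fun e => R e (s + t + s * t * e ^+ p) v 0 i)
  (fun e => R e s (R e t v) 0 i) _ _ _ 0; rewrite expr0n -(prednK p_gt0) /=.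
rewrite mulr0 addr0; apply.
- apply: polyfun_rescaled => [|j]; last exact: polyfun_cst.
  apply: polyfunD; first exact: polyfun_cst.
  apply: polyfunM; first exact: polyfun_cst.
  by apply: polyfunX; exact: polyfun_id.
- apply: polyfun_rescaled => [|j]; first exact: polyfun_cst.
  by apply: polyfun_rescaled => [|h]; exact: polyfun_cst.
- by move=> e e0; rewrite rescaled_mul // prednK.
Qed.

Definition limit_action (s : k) (v : V) : V :=
  exist _ (R 0 s (val v)) (mem_set (limit_V s (set_mem (valP v)))).

Definition limit_poly (i : 'I_n.+1) : {mpoly k[1 + n.+1]} :=
  \sum_(m < N) \sum_(d < N) 'X_(lshift n.+1 0) ^+ m * (0 ^+ `|weight m d|)%:MP
    * (b i m d \mPo [tuple 'X_(rshift 1 j) | j < n.+1]).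

Lemma limit_action_Ga : Ga_action limit_action.
Proof.
split=> [v|s t v|].
- by apply: val_inj; rewrite /= limit_0 //; exact: set_mem (valP v).
- by apply: val_inj; rewrite /= limit_add //; exact: set_mem (valP v).
- exists limit_poly => t v; apply/rowP => i; rewrite !mxE /eval_at /limit_poly.
  rewrite raddf_sum; apply: eq_bigr => m _; rewrite raddf_sum.
  apply: eq_bigr => d _; rewrite /= !mevalM rmorphXn /= mevalXU mevalC.
  rewrite comp_mpoly_meval row_mxEl mxE eqxx mulr1n; congr (_ * _).
  by apply: meval_eq => j; rewrite tnth_mktuple mevalXU row_mxEr.
Qed.

Lemma limit_action_mulrn t : (forall v, limit_action t v = v) ->
  forall v j, V v -> R 0 (j%:R * t) v = v.
Proof.
move=> tid v j Vv; elim: j => [|j IHj]; first by rewrite mul0r limit_0.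
rewrite mulrS mulrDl mul1r limit_add // IHj.
exact: (congr1 val (tid (exist _ v (mem_set Vv)))).
Qed.

(** The limit action would be effective if it had a term with m > 0: an element t
    acting trivially makes all its multiples j t act trivially, and a polynomial
    in s taking the same value at all these multiples is constant when t <> 0. *)
Lemma weight0_eval i m d v : (0 < m < N)%N -> (d < N)%N -> weight m d = 0 ->
  V v -> eval_at (b i m d) v = 0.
Proof.
move=> /andP[m0 mN] dN w0 Vv; apply/eqP; apply: contraT => bv.
case: Vrigid; exists limit_action; first exact: limit_action_Ga.
move=> t tid; apply/eqP; apply: contraT => t0; case/eqP: bv.
(* c m' is the coefficient of s^m' in coordinate i of the limit action at v;
   as q is nonzero, at most one degree has weight 0 for a given m'. *)
pose c m' := \sum_(d' < N) 0 ^+ `|weight m' d'| * eval_at (b i m' d') v.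
have cE : eval_at (b i m d) v = c m.
  rewrite /c (bigD1 (Ordinal dN)) //= w0 expr0 mul1r big1 ?addr0 // => d' dd'.
  suff /negPf w'0 : `|weight m d'|%N != 0%N by rewrite expr0n w'0 mul0r.
  apply: contraNneq dd' => /eqP; rewrite absz_eq0 => /eqP w'0; apply/eqP/val_inj.
  rewrite /=; have : q * (d'%:Z - d%:Z) = 0 by move: w0 w'0; rewrite /weight; lia.
  by move/eqP; rewrite mulf_eq0 (negPf q_neq0) /=; lia.
have : \poly_(m' < N) c m' = (v 0 i)%:P.
  apply: (poly_eq_on_multiples char0 t0) => j; rewrite hornerC.
  have /rowP/(_ i) := limit_action_mulrn tid j.+1 Vv; rewrite !mxE => <-.
  rewrite horner_poly; apply: eq_bigr => m' _; rewrite mulr_suml.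
  by apply: eq_bigr => d' _; rewrite mulrC mulrA.
move/(congr1 (coefp m)); rewrite /= coef_poly mN coefC.
by case: m m0 {mN w0} cE => // m' _ ->.
Qed.

End Weight.

Hypothesis N_gt1 : (1 < N)%N.

(** At s = 0 the action is the identity map, which is homogeneous of degree 1. *)
Lemma unit_degree1 i d v : (d < N)%N -> d != 1%N -> V v ->
  eval_at (b i 0 d) v = 0.
Proof.
move=> dN d1 Vv.
rewrite -[RHS](_ : (d == 1%N)%:R * v 0 i = 0); last by rewrite (negPf d1) mul0r.
pose c d := eval_at (b i 0 d) v; pose c' d := (d == 1%N)%:R * v 0 i.
apply: (@sum_powers_inj _ char0 N c c') dN => x x0.
transitivity ((x *: v) 0 i).
  have /rowP/(_ i) := T_0 (Vscale x Vv); rewrite !mxE => <-.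
  rewrite [RHS](bigD1 (Ordinal (ltnW N_gt1))) //=.
  rewrite [X in _ = _ + X]big1 ?addr0 => [|m m0]; last first.
    by rewrite big1 // => d' _; rewrite expr0n (negPf (m0 : m != 0%N :> nat)) mul0r.
  apply: eq_bigr => d' _.
  by rewrite expr0 mul1r (eval_at_scale _ _ (b_homog _ _ _)) mulrC.
rewrite (bigD1 (Ordinal N_gt1)) //= big1 ?addr0 => [|d' d'1]; last first.
  by rewrite /c' (negPf (d'1 : d' != 1%N :> nat)) !mul0r.
by rewrite /c' eqxx mul1r expr1 mxE mulrC.
Qed.

Definition in_support (m d : nat) : Prop :=
  exists i v, V v /\ eval_at (b i m d) v != 0.

Lemma in_supportP m d :
  ~ in_support m d -> forall i v, V v -> eval_at (b i m d) v = 0.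
Proof.
by move=> Nmd i v Vv; apply/eqP; apply: contraT => bv; case: Nmd; exists i, v.
Qed.

(** The smallest m for which degree 0 occurs gives the slope -1 / m of a limit
    action, which would act by translations along constant vectors. *)
Lemma no_degree0 m : (m < N)%N -> ~ in_support m 0.
Proof.
move=> mN; pose P m := (m < N)%N && `[< in_support m 0 >] => Sm.
have exP : exists m, P m by exists m; rewrite /P mN; apply/asboolP.
case: (ex_minnP exP) => {Sm mN}m /andP[mN /asboolP[i [v [Vv bv]]]] m_min.
have [m0|m_gt0] := posnP m.
  by case/eqP: bv; rewrite m0 unit_degree1 // ltnW.
case/eqP: bv; apply: (@weight0_eval 1 (- m%:Z)) => //; first lia.
- move=> j m' d' w Vw bw; rewrite /weight.
  have [d'0|d'_gt0] := posnP d'; last by nia.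
  suff : (m <= m')%N by rewrite d'0; lia.
  by apply: m_min; rewrite /P ltn_ord; apply/asboolP; exists j, w; rewrite -d'0.
- by rewrite m_gt0.
- exact: ltnW.
- by rewrite /weight; lia.
Qed.

(** The terms of largest slope (d - 1) / m have weight 0 for a suitable weight that
    is nonnegative on the other terms. *)
Lemma no_degree_gt1 m d : (m < N)%N -> (1 < d < N)%N -> ~ in_support m d.
Proof.
move=> mN /andP[d1 dN]; have [->|m_gt0] := posnP m.
  by case=> i [v [Vv]]; rewrite unit_degree1 ?eqxx // gtn_eqF.
pose P (x : 'I_N * 'I_N) :=
  [&& 0 < x.1, 1 < x.2 & `[< in_support x.1 x.2 >]]%N.
pose slope (x : 'I_N * 'I_N) : rat := x.2.-1%:R / x.1%:R.
move=> Smd; have Px : P (Ordinal mN, Ordinal dN).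
  by rewrite /P /= m_gt0 d1; apply/asboolP.
case: (Order.TotalTheory.arg_maxP slope Px) => -[{Smd Px m_gt0 d1}m {mN dN}d] /=.
case/and3P=> /= m_gt0 d1 /asboolP[i [v [Vv bv]]] slope_max.
case/eqP: bv; apply: (@weight0_eval d.-1 m%:Z) => //; try lia.
- move=> j m' d' w Vw bw; rewrite /weight.
  have [m'0|m'_gt0] := posnP m'.
    have [->|d'1] := eqVneq (d' : nat) 1%N; first by lia.
    by case/eqP: bw; rewrite m'0 unit_degree1.
  have [d'1|d'_gt1] := leqP d' 1; first by nia.
  have /slope_max : P (m', d').
    by rewrite /P /= m'_gt0 d'_gt1; apply/asboolP; exists j, w.
  rewrite /slope /= ler_pdivrMr ?ltr0n // mulrAC ler_pdivlMr ?ltr0n //.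
  by rewrite -!natrM ler_nat; lia.
- by rewrite m_gt0 /=.
- by rewrite /weight; lia.
Qed.

Lemma degree1_only i m d v : (m < N)%N -> (d < N)%N -> d != 1%N -> V v ->
  eval_at (b i m d) v = 0.
Proof.
move=> mN dN d1 Vv; apply: in_supportP => //.
have [d0|d_gt0] := posnP d; first by rewrite d0; exact: no_degree0.
by apply: no_degree_gt1 => //; rewrite dN andbT; lia.
Qed.

(** Only the parts of degree 1 survive on V. *)
Lemma expanded_action_scale s c v : V v -> T s (c *: v) = c *: T s v.
Proof.
move=> Vv; apply/rowP => i; rewrite !mxE mulr_sumr; apply: eq_bigr => m _.
rewrite mulr_sumr; apply: eq_bigr => d _.
rewrite (eval_at_scale _ _ (b_homog _ _ _)).
have [->|d1] := eqVneq (d : nat) 1%N; first by rewrite expr1 mulrCA.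
by rewrite degree1_only // !mulr0.
Qed.

End Degeneration.

(** * Conjugates of the dilations of a rigid cone *)

Section ConjugateTorus.
Variables (k : fieldType) (n : nat) (V : set 'rV[k]_n.+1).
Hypothesis char0 : [pchar k] =i pred0.
Variable S : set {mpoly k[n.+1]}.
Hypothesis VE : forall v, V v <-> forall f, S f -> eval_at f v = 0.
Hypothesis Vscale : forall c v, V v -> V (c *: v).
Hypothesis Vrigid : rigid V.

Definition dilate (c : k) (v : V) : V :=
  exist _ (c *: val v) (mem_set (Vscale c (set_mem (valP v)))).

Lemma dilateM c d v : dilate c (dilate d v) = dilate (c * d) v.
Proof. by apply: val_inj; rewrite /= scalerA. Qed.

Lemma dilate1 v : dilate 1 v = v.
Proof. by apply: val_inj; rewrite /= scale1r. Qed.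

Lemma sum_binomial N j (s : k) : (j < N)%N ->
  \sum_(m < N) s ^+ m * 'C(j, m)%:R = (1 + s) ^+ j.
Proof.
move=> jN; rewrite addrC exprD1n (big_ord_widen N (fun m => s ^+ m *+ 'C(j, m))) //.
rewrite [RHS]big_mkcond; apply: eq_bigr => m _; rewrite mulr_natr.
by case: ltnP => // mj; rewrite bin_small // mulr0n.
Qed.

(** For inverse g and h, the maps h (t . g v) form an action of the multiplicative
    monoid k on V to which the degeneration argument applies. It is polynomial
    in t, even at t = 0, which acts by a constant map. *)
Lemma conjugate_dilate_linear (g h : V -> V) :
  regular_endo g -> regular_endo h -> cancel g h -> cancel h g ->
  forall t c v, h (dilate t (g (dilate c v))) = dilate c (h (dilate t (g v))).
Proof.
move=> [P gP] [Q hQ] gK hK.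
(* h (t . g v) is the sum over j of t^j times the parts comp i j, and t^j is
   expanded by the binomial formula in powers of s = t - 1. *)
pose comp i j := poly_comp (fun i => pihomog mdeg j (Q i)) P i.
pose N0 := \max_i msize (Q i).
pose N := maxn 2 (maxn N0 (\max_i \max_(j < N0) msize (comp i j))).
have N0N : (N0 <= N)%N by rewrite /N; lia.
have compN i (j : 'I_N0) : (msize (comp i j) <= N)%N.
  apply: leq_trans (@leq_bigmax _ (fun j : 'I_N0 => msize (comp i j)) j) _.
  apply: leq_trans (@leq_bigmax _ (fun i => \max_(j < N0) msize (comp i j)) i) _.
  by rewrite /N; lia.
pose b i m d := \sum_(j < N0) 'C(j, m)%:R *: pihomog mdeg d (comp i j).
have bh i m d : b i m d \is d.-homog.
  by apply: rpred_sum => j _; apply/dhomogZ/pihomogP.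
have TE s v : expanded_action N b s (val v) = val (h (dilate (1 + s) (g v))).
  rewrite hQ; apply/rowP => i.
  rewrite !mxE (eval_at_hparts _ (@leq_bigmax _ (fun i => msize (Q i)) i)).
  transitivity (\sum_(m < N) \sum_(j < N0) \sum_(d < N)
      s ^+ m * eval_at ('C(j, m)%:R *: pihomog mdeg d (comp i j)) (val v)).
    apply: eq_bigr => m _; rewrite exchange_big; apply: eq_bigr => d _ /=.
    by rewrite /eval_at raddf_sum mulr_sumr.
  rewrite exchange_big; apply: eq_bigr => j _ /=.
  rewrite (eval_at_scale _ _ (pihomogP _ _ _)) gP.
  rewrite -(sum_binomial s (leq_trans (ltn_ord j) N0N)) mulr_suml.
  have -> : eval_at (pihomog mdeg j (Q i)) (poly_map P (val v)) =
      eval_at (comp i j) (val v).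
    have /rowP/(_ i) := poly_map_comp (fun i => pihomog mdeg j (Q i)) P (val v).
    by rewrite !mxE.
  apply: eq_bigr => m _; rewrite (eval_at_hparts _ (compN i j)) mulr_sumr.
  by apply: eq_bigr => d _; rewrite /eval_at mevalZ mulrA.
have T_sub s v : V v -> exists2 w : V, val w = v &
    expanded_action N b s v = val (h (dilate (1 + s) (g w))).
  by move=> Vv; exists (exist _ v (mem_set Vv)); rewrite -?TE.
move=> t c v; apply: val_inj => /=.
have -> : t = 1 + (t - 1) by rewrite addrC subrK.
rewrite -!TE /= (@expanded_action_scale _ _ V char0 S) //.
- by move=> s w /(T_sub s)[{}w _ ->]; exact: set_mem (valP _).
- by move=> w /(T_sub 0)[{}w <- ->]; rewrite addr0 dilate1 gK.
- move=> s s' _ /(T_sub s')[w <- ->]; rewrite !TE hK dilateM.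
  congr (val (h (dilate _ _))).
  by rewrite mulrDl mul1r mulrDr mulr1 !addrA; congr (_ + _); rewrite addrAC.
- by rewrite /N; lia.
- exact: set_mem (valP v).
Qed.

End ConjugateTorus.

(** * The cone over a projective set and its equivariant self-maps *)

Section Cone.
Variables (k : fieldType) (n : nat) (X : set (projspace k n)).
Implicit Types (v w : 'rV[k]_n.+1) (x : projspace k n).

Lemma coords_scaled x v c : c != 0 -> coords x (c *: v) -> coords x v.
Proof.
move=> c0 xcv; rewrite /coords xcv; apply/eqP; rewrite eqEsubv -!memvE.
apply/andP; split; apply/vlineP; first by exists c.
by exists c^-1; rewrite scalerA mulVf // scale1r.
Qed.

Lemma line_ex v : v != 0 -> exists x, coords x v.
Proof.
move=> v0; have v1 : \dim <[v]>%VS == 1%N by rewrite dim_vline v0.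
by exists (exist _ <[v]>%VS v1).
Qed.

Lemma coords_inj x y v : coords x v -> coords y v -> x = y.
Proof. by rewrite /coords => xv yv; apply: val_inj; rewrite /= xv yv. Qed.

Lemma homogeneous_idealW f : homogeneous f ->
  (forall x, X x -> vanishes_at f x) -> homogeneous_ideal X f.
Proof.
move=> fh fX; exists [:: (1, f)]; last by rewrite big_seq1 mul1r.
by move=> c; rewrite inE => /eqP ->.
Qed.

Lemma homogeneous_ideal_coords f x v :
  homogeneous_ideal X f -> X x -> coords x v -> eval_at f v = 0.
Proof.
move=> [s sX ->] Xx xv; rewrite /eval_at raddf_sum big_seq big1 // => c cs.
have [_ /(_ _ Xx _ xv) c2] := sX _ cs.
by rewrite /= mevalM -/(eval_at c.2 v) c2 mulr0.
Qed.

Lemma cone_coords x v : X x -> coords x v -> affine_cone X v.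
Proof. by move=> Xx xv f fX; exact: homogeneous_ideal_coords fX Xx xv. Qed.

Lemma cone_scale c v : affine_cone X v -> affine_cone X (c *: v).
Proof.
move=> Vv f [s sX ->]; rewrite /eval_at raddf_sum big_seq big1 // => g gs.
have [[d gd] gX] := sX _ gs.
rewrite /= mevalM -/(eval_at g.2 _) (eval_at_scale _ _ gd) Vv ?mulr0 ?mulr0 //.
by apply: homogeneous_idealW => //; exists d.
Qed.

Hypothesis Xclosed : closed_subset X.

(** The forms that define X lie in its homogeneous ideal, so they vanish on the cone. *)
Lemma cone_point x v : affine_cone X v -> coords x v -> X x.
Proof.
case: Xclosed => S Sh XE Vv xv; rewrite XE => f Sf w xw.
have [d fd] := Sh _ Sf; have [c _ ->] := coords_scale xv xw.
rewrite (eval_at_scale _ _ fd) Vv ?mulr0 //.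
by apply: homogeneous_idealW => [|y]; [exact: Sh | rewrite XE; apply].
Qed.

Local Notation V := (affine_cone X).
Local Notation dil := (dilate cone_scale).

Definition equivariant (g : V -> V) : Prop :=
  forall c (v : V), g (dil c v) = dil c (g v).

Definition induces (g : V -> V) (h : X -> X) : Prop :=
  forall (v : V) (x : X),
    coords (val x) (val v) -> coords (val (h x)) (val (g v)).

Lemma coords_in_cone (x : X) v : coords (val x) v -> exists w : V, val w = v.
Proof.
move=> xv; have Vv := cone_coords (set_mem (valP x)) xv.
by exists (exist _ v (mem_set Vv)).
Qed.

Lemma coords_in_base (v : V) : val v != 0 -> exists x : X, coords (val x) (val v).
Proof.
move=> /line_ex[x xv]; have Xx := cone_point (set_mem (valP v)) xv.
by exists (exist _ x (mem_set Xx)).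
Qed.

Lemma induces_eq g h1 h2 : induces g h1 -> induces g h2 -> h1 =1 h2.
Proof.
move=> gh1 gh2 x; have [v xv] := coords_ex (val x).
have [w wv] := coords_in_cone xv; rewrite -wv in xv.
by apply: val_inj; exact: coords_inj (gh1 _ _ xv) (gh2 _ _ xv).
Qed.

Lemma induces_comp g1 g2 h1 h2 :
  induces g1 h1 -> induces g2 h2 -> induces (g1 \o g2) (h1 \o h2).
Proof. by move=> gh1 gh2 v x xv; apply/gh1/gh2. Qed.

Lemma equivariant0 g (v : V) : equivariant g -> val v = 0 -> val (g v) = 0.
Proof.
move=> gE v0; have -> : v = dil 0 v by apply: val_inj; rewrite /= scale0r.
by rewrite gE /= scale0r.
Qed.

Lemma equivariant_neq0 g (v : V) : equivariant g -> injective g ->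
  val v != 0 -> val (g v) != 0.
Proof.
move=> gE gI; apply: contraNneq => gv0.
suff -> : v = dil 0 v by rewrite /= scale0r.
by apply: gI; rewrite gE; apply: val_inj; rewrite /= gv0 scaler0.
Qed.

Lemma induced_map g : equivariant g -> injective g -> exists h, induces g h.
Proof.
move=> gE gI.
suff /choice[h hP] : forall x : X, exists y : X, forall v : V,
    coords (val x) (val v) -> coords (val y) (val (g v)).
  by exists h => v x; exact: hP.
move=> x; have [v xv] := coords_ex (val x).
have [w wv] := coords_in_cone xv; rewrite -wv in xv.
have [y yw] := coords_in_base (equivariant_neq0 gE gI (coords_neq0 xv)).
exists y => u xu; have [c c0 uE] := coords_scale xu xv.
apply: (coords_scaled c0); have -> : c *: val (g u) = val (dil c (g u)) by [].
rewrite -gE; suff -> : dil c u = w by [].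
by apply: val_inj; rewrite /= uE.
Qed.

Hypothesis char0 : [pchar k] =i pred0.

(** A polynomial map P with P(c v) = c P(v) on V agrees on V with its part of
    degree 1, by comparison of the powers of c. *)
Lemma equivariant_linear (g : V -> V) : regular_endo g -> equivariant g ->
  exists2 F : 'I_n.+1 -> {mpoly k[n.+1]}, forall i, F i \is 1.-homog
    & forall v : V, val (g v) = poly_map F (val v).
Proof.
move=> [P gP] gE; exists (fun i => pihomog mdeg 1 (P i)) => [i|v].
  exact: pihomogP.
apply/rowP => i; rewrite mxE; pose N := (msize (P i)).+2.
pose c d := eval_at (pihomog mdeg d (P i)) (val v).
pose c' d := (d == 1%N)%:R * val (g v) 0 i.
rewrite -/(c 1%N) -[LHS]mul1r -/(c' 1%N).
apply/esym/(@sum_powers_inj _ char0 N c c') => // x x0.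
transitivity (val (g (dil x v)) 0 i).
  rewrite gP mxE (@eval_at_hparts _ _ _ N) /N; last by lia.
  by apply: eq_bigr => d _; rewrite (eval_at_scale _ _ (pihomogP _ _ _)) mulrC.
rewrite gE /= mxE (bigD1 (Ordinal (isT : (1 < N)%N))) //= big1 ?addr0 => [|d d1].
  by rewrite /c' mul1r mulrC.
by rewrite /c' (negPf (d1 : d != 1%N :> nat)) !mul0r.
Qed.

Lemma induced_regular g h : regular_endo g -> equivariant g -> injective g ->
  induces g h -> projective_regular_endo h.
Proof.
move=> gR gE gI gh x; have [F F1 gF] := equivariant_linear gR gE.
exists 1%N, F; split=> // [v xv|y v yv _].
  have [w wv] := coords_in_cone xv; rewrite -wv -gF.
  by apply: equivariant_neq0 => //; rewrite wv; exact: coords_neq0 xv.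
have [w wv] := coords_in_cone yv; rewrite -wv -gF.
by apply: gh; rewrite wv.
Qed.

(** The linear forms of equivariant_linear define the induced map at once on the
    whole of X, and the inverse of an equivariant automorphism is equivariant. *)
Lemma induced_aut (g : affine_aut V) : equivariant (aut_fun g) ->
  exists h : projective_aut X, induces (aut_fun g) (aut_fun h).
Proof.
move=> gE; have [gR [g' [g'R gK g'K]]] : is_aut (affine_endo V) (aut_fun g).
  exact: asboolW (valP g).
have g'E : equivariant g'.
  by move=> c v; apply: (can_inj gK); rewrite gE !g'K.
have [h gh] := induced_map gE (can_inj gK).
have [h' g'h'] := induced_map g'E (can_inj g'K).
have hP : is_aut (projective_endo X) h.
  split; first exact: induced_regular gR gE (can_inj gK) gh.
  exists h'; split.
  - exact: induced_regular g'R g'E (can_inj g'K) g'h'.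
  - apply: (@induces_eq (g' \o aut_fun g)); first exact: induces_comp.
    by move=> v x; rewrite /= gK.
  - apply: (@induces_eq (aut_fun g \o g')); first exact: induces_comp.
    by move=> v x; rewrite /= g'K.
by exists (exist _ h (asboolT hP)).
Qed.

End Cone.

(** * Homomorphisms from the torus to a finite group *)

(** If N elements exhaust the group, two of the powers of x with exponents 0, .., N
    are equal, so x has order at most N and N! is a common exponent. *)
Lemma finite_group_exponent (G : groupType) : finite_set [set: G] ->
  exists2 N : nat, (0 < N)%N & forall x : G, (x ^+ N = 1)%g.
Proof.
move=> /finite_seqP[s sE]; exists (size s)`!; first exact: fact_gt0.
move=> x; suff [d /andP[d0 ds] xd] : exists2 d, (0 < d <= size s)%N & (x ^+ d = 1)%g.
  have /dvdnP[e ->] : (d %| (size s)`!)%N by rewrite dvdn_fact ?d0.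
  by rewrite mulnC expgnA xd expg1n.
have [//|Nx] := pselect (exists2 d, (0 < d <= size s)%N & (x ^+ d = 1)%g).
have /uniq_leq_size : uniq [seq (x ^+ j)%g | j <- iota 0 (size s).+1].
  rewrite map_inj_in_uniq ?iota_uniq // => i j; rewrite !mem_iota /= !add0n.
  wlog ij : i j / (i <= j)%N.
    by move=> H si sj xij; case/orP: (leq_total i j) => /H E; [|apply/esym]; apply: E.
  move=> _ sj xij; apply/eqP; rewrite eqn_leq ij leqNgt /=; apply/negP => lt_ij.
  case: Nx; exists (j - i)%N; first by rewrite subn_gt0 lt_ij /=; lia.
  by apply: (@mulgI _ (x ^+ i)%g); rewrite -expgnDr subnKC // mulg1 xij.
move=> /(_ s); rewrite size_map size_iota ltnn => H; suff: false by []; apply: H.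
by move=> y _; have : [set: G] y by []; rewrite sE.
Qed.

Lemma exists_root (k : closedFieldType) (t : k) N :
  (0 < N)%N -> exists s, s ^+ N = t.
Proof.
move=> N0; have [s sN] := solve_monicpoly (fun i => t *+ (i == 0%N)) N0.
exists s; rewrite sN (bigD1 (Ordinal N0)) //= expr0 mulr1 big1 ?addr0 // => i i0.
by rewrite (negPf (i0 : i != 0%N :> nat)) mulr0n mul0r.
Qed.

(** Every element of the torus is an N-th power, where N is an exponent of the
    finite group. *)
Lemma Gm_to_finite_trivial (k : closedFieldType) (G : groupType) (f : Gm k -> G) :
  finite_set [set: G] -> {morph f : s t / (s * t)%g} -> forall t, f t = 1%g.
Proof.
move=> /finite_group_exponent[N N0 GN] fM t.
have [s sN] := exists_root (val t) N0.
have s0 : s != 0.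
  by apply: contraTneq (valP t) => s0; rewrite -sN s0 expr0n gtn_eqF // eqxx.
have f1 : f 1%g = 1%g by apply: (@mulgI _ (f 1%g)); rewrite -fM !mulg1.
pose s' : Gm k := exist _ s s0.
have -> : t = (s' ^+ N)%g.
  apply: val_inj; rewrite -sN; elim: N {N0 GN sN} => // N /= IHN.
  by rewrite expgS exprS IHN.
rewrite -(GN (f s')); elim: N {N0 GN sN} => [|N IHN]; first by rewrite !expg0.
by rewrite !expgS fM IHN.
Qed.

(** * Automorphisms of a rigid cone commute with dilations *)

Section ConeAutomorphisms.
Variables (k : closedFieldType) (n : nat) (X : set (projspace k n)).
Hypothesis char0 : [pchar k] =i pred0.
Hypothesis Xclosed : closed_subset X.
Local Notation V := (affine_cone X).
Local Notation dil := (dilate (@cone_scale k n X)).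

Lemma dilate_regular c : regular_endo (dil c).
Proof.
exists (fun i => c *: 'X_i) => v; apply/rowP => i.
by rewrite !mxE /eval_at mevalZ mevalXU.
Qed.

Lemma dilate_is_aut (t : Gm k) : is_aut (affine_endo V) (dil (val t)).
Proof.
split; first exact: dilate_regular.
exists (dil (val t)^-1); split; first exact: dilate_regular.
- by move=> v; rewrite dilateM mulVf ?(valP t) // dilate1.
- by move=> v; rewrite dilateM mulfV ?(valP t) // dilate1.
Qed.

Definition homothety (t : Gm k) : affine_aut V :=
  exist _ (dil (val t)) (asboolT (dilate_is_aut t)).

Lemma homothetyM : {morph homothety : s t / (s * t)%g}.
Proof. by move=> s t; apply: aut_eqP => v; apply: val_inj; rewrite /= scalerA. Qed.

Hypothesis Vrigid : rigid V.

Lemma conjugate_equivariant (g : affine_aut V) t :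
  equivariant (fun v => aut_fun g^-1%g (dil t (aut_fun g v))).
Proof.
have regular (h : affine_aut V) : regular_endo (aut_fun h).
  by case: (asboolW (valP h)).
move=> c v; apply: (@conjugate_dilate_linear _ _ V char0 (homogeneous_ideal X));
  rewrite //; [exact: autK | exact: aut_invK].
Qed.

Hypothesis AutX_fin : finite_set [set: projective_aut X].

(** The conjugates of the dilations induce a homomorphism from the torus to
    Aut(X), which is trivial as Aut(X) is finite. *)
Lemma conjugate_preserves_lines (g : affine_aut V) t (v : V) : t != 0 ->
  exists c, val (aut_fun g^-1%g (dil t (aut_fun g v))) = c *: val v.
Proof.
move=> t0; pose tau s := (g^-1 * homothety s * g)%g.
have tauE s : equivariant (aut_fun (tau s)) by exact: conjugate_equivariant.
have /choice[f fP] s := induced_aut Xclosed char0 (tauE s).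
have fM : {morph f : s t / (s * t)%g}.
  move=> r s; apply/aut_eqP/(induces_eq (fP (r * s)%g)).
  have -> : tau (r * s)%g = (tau r * tau s)%g.
    by rewrite /tau homothetyM !mulgA mulgK.
  exact: induces_comp.
have [v0|v0] := eqVneq (val v) 0.
  by exists 0; rewrite scale0r (equivariant0 (@conjugate_equivariant g t)).
have [x xv] := coords_in_base Xclosed v0.
have := fP (exist _ t t0) v x xv; rewrite (Gm_to_finite_trivial AutX_fin fM).
by move=> xtv; have [c _ ->] := coords_scale xv xtv; exists c.
Qed.

Lemma scaler_injl (U : lmodType k) (w : U) : w != 0 -> injective (fun a : k => a *: w).
Proof.
move=> w0 a b /eqP; rewrite -subr_eq0 -scalerBl scaler_eq0 (negPf w0) orbF.
by rewrite subr_eq0 => /eqP.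
Qed.

Lemma regular_on_line (f : V -> V) (v : V) (w : 'rV[k]_n.+1) :
  regular_endo f -> w != 0 -> (forall t, exists c, val (f (dil t v)) = c *: w) ->
  exists p : {poly k}, forall t, val (f (dil t v)) = p.[t] *: w.
Proof.
move=> [P fP] /rV0Pn[j wj] fw.
have [p pE] : polyfun (fun t => eval_at (P j) (t *: val v)).
  apply: polyfun_eval => i.
  apply: polyfun_ext (polyfunM (polyfun_id k) (polyfun_cst (val v 0 i))) => t.
  by rewrite mxE.
exists ((w 0 j)^-1 *: p) => t; have [c cE] := fw t; rewrite cE; congr (_ *: _).
rewrite hornerZ -pE; have -> : t *: val v = val (dil t v) by [].
have <- : val (f (dil t v)) 0 j = eval_at (P j) (val (dil t v)).
  by rewrite fP mxE.
by rewrite cE mxE mulrCA mulVf // mulr1.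
Qed.

(** The automorphism g and its inverse are given by polynomials p and q between
    the lines of v and of g v. As q(p(s)) = s, the polynomial p has degree 1, and
    it takes the value 0 at 0 and 1 at 1. *)
Lemma aut_equivariant (g : affine_aut V) : equivariant (aut_fun g).
Proof.
have regular (h : affine_aut V) : regular_endo (aut_fun h).
  by case: (asboolW (valP h)).
(* The zero dilation maps every point to the origin; equivariance at the origin
   of its conjugate by h says that h fixes the origin. *)
have g0 (h : affine_aut V) (v : V) : val v = 0 -> val (aut_fun h v) = 0.
  move=> v0; have dil0 w : dil 0 w = v by apply: val_inj; rewrite /= scale0r v0.
  have := conjugate_equivariant h 0 0 v; rewrite !dil0 => /(congr1 (aut_fun h)).
  by rewrite aut_invK => <-.
move=> t v; have [v0|v0] := eqVneq (val v) 0.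
  by apply: val_inj; rewrite /= !g0 ?scaler0 //= v0 scaler0.
have gv0 : val (aut_fun g v) != 0.
  apply: contraNneq v0 => gv0; have := g0 g^-1%g _ gv0.
  by rewrite (autK g v) => ->.
have gline s : exists c, val (aut_fun g (dil s v)) = c *: val (aut_fun g v).
  have [->|s0] := eqVneq s 0.
    by exists 0; rewrite scale0r g0 //= scale0r.
  have := conjugate_preserves_lines g^-1%g (aut_fun g v) s0.
  by rewrite invgK (autK g v).
have hline s : exists c, val (aut_fun g^-1%g (dil s (aut_fun g v))) = c *: val v.
  have [->|s0] := eqVneq s 0; last exact: conjugate_preserves_lines.
  by exists 0; rewrite scale0r g0 //= scale0r.
have [p pE] := regular_on_line (regular g) gv0 gline.
have [q qE] := regular_on_line (regular g^-1%g) v0 hline.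
have qpX : q \Po p = 'X.
  apply: (poly_eq_off0 char0) => s _; rewrite horner_comp hornerX.
  apply: (scaler_injl v0); rewrite -qE.
  have -> : dil p.[s] (aut_fun g v) = aut_fun g (dil s v).
    by apply: val_inj; rewrite /= pE.
  by rewrite (autK g).
have size_p : (size p <= 2)%N.
  have := size_comp_poly q p; rewrite qpX size_polyX /=.
  by case: (size p) => [|[|[|m]]] //; case: (size q).-1 => //= e; lia.
have p_at s : p.[s] = p`_0 + p`_1 * s.
  rewrite (horner_coef_wide _ size_p) big_ord_recl big_ord1 expr0 mulr1 expr1 //.
have p0 : p.[0] = 0.
  apply: (scaler_injl gv0); rewrite -pE scale0r g0 //= scale0r //.
have p1 : p.[1] = 1.
  apply: (scaler_injl gv0); rewrite -pE scale1r dilate1 //.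
apply: val_inj; rewrite /= pE; congr (_ *: _).
move: p0 p1; rewrite !p_at mulr0 addr0 => -> /=; rewrite !add0r mulr1 => ->.
by rewrite mul1r.
Qed.

(** * Linear maps that preserve all lines of the cone *)

Lemma linear_formE (R : nzRingType) m (f : {mpoly R[m]}) :
  f \is 1.-homog -> f = \sum_j f@_U_(j) *: 'X_j.
Proof.
move=> /dhomogP f1; apply/mpolyP => u; rewrite raddf_sum /=.
under eq_bigr do rewrite mcoeffZ mcoeffX.
have [/mdeg1P[j /eqP ->]|u1] := boolP (mdeg u == 1%N).
  rewrite (bigD1 j) //= eqxx mulr1 big1 ?addr0 // => i ij.
  by rewrite eq_mnm1 (negPf ij) mulr0.
rewrite memN_msupp_eq0 ?big1 // => [i _|].
  by rewrite (_ : _ == u = false) ?mulr0 //; apply: contraNF u1 => /eqP <-; rewrite mdeg1.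
by apply: contra u1 => /f1 /eqP.
Qed.

Lemma homogeneous_ideal_cone f : homogeneous f ->
  (forall v : V, eval_at f (val v) = 0) -> homogeneous_ideal X f.
Proof.
move=> fh fV; apply: homogeneous_idealW => // x Xx v xv.
by rewrite -(fV (exist _ v (mem_set (cone_coords Xx xv)))).
Qed.

Hypothesis Xne : X !=set0.

Lemma nonzero_in_cone : exists v : V, val v != 0.
Proof.
have [x Xx] := Xne; have [v xv] := coords_ex x.
exists (exist _ v (mem_set (cone_coords Xx xv))); exact: coords_neq0 xv.
Qed.

Hypothesis Xnorm : projectively_normal X.

(** The eigenvalue at v is F i / X_i at v, whenever the coordinate i of v is
    nonzero. This quotient z, taken in the function field K, does not depend on i,
    because F i X_j = F j X_i on V; hence (X_j)_j is an eigenvector over K of the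
    matrix of F, which has its entries in k. The characteristic polynomial splits
    over k, so z lies in k. *)
Lemma eigenvalue_constant (g : V -> V) (F : 'I_n.+1 -> {mpoly k[n.+1]}) :
  (forall i, F i \is 1.-homog) -> (forall v, val (g v) = poly_map F (val v)) ->
  (forall v : V, exists c, val (g v) = c *: val v) ->
  exists c, forall v, val (g v) = c *: val v.
Proof.
move=> F1 gF gline; have [K [phi [ker_phi _ _]]] := Xnorm.
have phi_eq f1 f2 d : f1 \is d.-homog -> f2 \is d.-homog ->
    (forall v : V, eval_at f1 (val v) = eval_at f2 (val v)) <-> phi f1 = phi f2.
  move=> f1d f2d; have fE v : eval_at (f1 - f2) v = eval_at f1 v - eval_at f2 v.
    by rewrite /eval_at mevalB.
  split=> [f12|/eqP].
    apply/eqP; rewrite -subr_eq0 -rmorphB; apply/eqP/ker_phi.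
    apply: homogeneous_ideal_cone; first by exists d; exact: rpredB.
    by move=> v; rewrite fE f12 subrr.
  rewrite -subr_eq0 -rmorphB => /eqP/ker_phi f12 v; apply/eqP.
  by rewrite -subr_eq0 -fE; apply/eqP/(set_mem (valP v)).
have X1 i : ('X_i : {mpoly k[n.+1]}) \is 1.-homog by rewrite dhomogX /= mdeg1.
have [i0 xi0] : exists i, phi 'X_i != 0.
  have [v v0] := nonzero_in_cone; have /rV0Pn[i vi] := v0; exists i.
  apply: contraNneq vi => /ker_phi /(set_mem (valP v)).
  by rewrite /eval_at mevalXU => ->.
pose z := phi (F i0) / phi 'X_i0.
have zE i : phi (F i) = z * phi 'X_i.
  rewrite /z mulrAC; apply: (mulIf xi0); rewrite mulfVK // -!rmorphM.
  apply/(phi_eq _ _ 2); [exact: dhomogM | exact: dhomogM |].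
  move=> v; have [c cE] := gline v.
  have FE j : eval_at (F j) (val v) = c * val v 0 j.
    by have /rowP/(_ j) := gF v; rewrite cE !mxE.
  rewrite /eval_at !mevalM -!/(eval_at _ _) !FE /eval_at !mevalXU.
  by rewrite mulrAC.
pose iota : {rmorphism k -> K} := phi \o @mpolyC n.+1 k.
pose A : 'M[k]_n.+1 := \matrix_(j, i) (F i)@_U_(j).
have [c zc] : exists c, z = iota c.
  have : root (char_poly (map_mx iota A)) z.
    rewrite -eigenvalue_root_char; apply/eigenvalueP.
    exists (\row_j phi 'X_j); last first.
      by apply/rV0Pn; exists i0; rewrite mxE.
    apply/rowP => i; rewrite !mxE -zE [in RHS](linear_formE (F1 i)) rmorph_sum.
    apply: eq_bigr => j _; rewrite !mxE /= -mul_mpolyC rmorphM mulrC //.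
  rewrite -map_char_poly; have [r ->] := closed_field_poly_normal (char_poly A).
  rewrite (monicP (char_poly_monic A)) scale1r rmorph_prod /=.
  under eq_bigr do rewrite rmorphB /= map_polyX map_polyC /=.
  rewrite -(big_map iota xpredT (fun a => 'X - a%:P)) root_prod_XsubC.
  by case/mapP => c _ ->; exists c.
exists c => v; rewrite gF; apply/rowP => i; rewrite !mxE.
have -> : eval_at (F i) (val v) = eval_at (c *: 'X_i) (val v).
  apply: (iffRL (phi_eq _ _ 1%N _ _)) v; first exact: F1.
    exact: rpredZ.
  by rewrite zE zc -mul_mpolyC rmorphM.
by rewrite /eval_at mevalZ mevalXU.
Qed.

End ConeAutomorphisms.

Unset Implicit Arguments.

Theorem theorem1p20 (k : closedFieldType) (char0 : [pchar k] =i pred0) (n : nat)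
    (X : set (projspace k n)) (Xvar : subvariety X)
    (Xnorm : projectively_normal X) (Vrigid : rigid (affine_cone X))
    (AutX_fin : finite_set [set: projective_aut X]) :
  exists (i : {multiplicative Gm k -> affine_aut (affine_cone X)})
         (p : {multiplicative affine_aut (affine_cone X) -> projective_aut X}),
    [/\ forall (t : Gm k) (v : affine_cone X), val (aut_fun (i t) v) = val t *: val v,
        forall (g : affine_aut (affine_cone X)) (v : affine_cone X) (x : X),
          coords (val x) (val v) -> coords (val (aut_fun (p g) x)) (val (aut_fun g v)),
        injective i,
        range i = [set g | p g = 1%g]
      & finite_set (range p)].
Proof.
have [Xclosed Xne _] := Xvar.
have gE := aut_equivariant char0 Xclosed Vrigid AutX_fin.
have /choice[p pP] g := induced_aut Xclosed char0 (gE g).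
have pM : {morph p : g h / (g * h)%g}.
  by move=> g h; apply/aut_eqP/(induces_eq (pP (g * h)%g)); exact: induces_comp.
pose i : {multiplicative Gm k -> affine_aut (affine_cone X)} :=
  HB.pack (@homothety k n X) (isMultiplicative.Build _ _ _ (@homothetyM k n X)).
pose p' : {multiplicative affine_aut (affine_cone X) -> projective_aut X} :=
  HB.pack p (isMultiplicative.Build _ _ _ pM).
exists i, p'; have [v v0] := nonzero_in_cone Xne.
split=> //.
- move=> s t st; apply/val_inj/(scaler_injl v0).
  by have /(congr1 (fun g => val (aut_fun g v))) := st.
- apply/seteqP; split=> [_ [t _ <-]|g pg1] /=.
    apply/aut_eqP/(induces_eq (pP _)) => w x xw.
    (* A dilation preserves lines, so the identity of X is induced by it. *)
    apply: (@coords_scaled _ _ _ _ (val t)^-1); first by rewrite invr_neq0 ?(valP t).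
    by rewrite /= scalerA mulVf ?(valP t) // scale1r.
  have [gR _] : is_aut (affine_endo (affine_cone X)) (aut_fun g).
    exact: asboolW (valP g).
  have [F F1 gF] := equivariant_linear char0 gR (gE g).
  have gline w : exists c, val (aut_fun g w) = c *: val w.
    have [w0|/(coords_in_base Xclosed)[x xw]] := eqVneq (val w) 0.
      by exists 0; rewrite scale0r (equivariant0 (gE g)).
    have := pP g w x xw; rewrite (_ : p g = 1%g) // => xgw.
    by have [c _ ->] := coords_scale xw xgw; exists c.
  have [c gc] := eigenvalue_constant Xne Xnorm F1 gF gline.
  have c0 : c != 0.
    apply: contraNneq v0 => c0; have := gc v; rewrite c0 scale0r => gv0.
    by rewrite -(autK g v) (equivariant0 (gE g^-1%g)).
  exists (exist _ c c0) => //; apply: aut_eqP => w; apply: val_inj.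
  by rewrite gc.
- exact: sub_finite_set AutX_fin.
Qed.
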